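(* Let $(A,\mathcal{R})$ be a confluent noetherian rewriting system such that the set of left-hand sides of rewriting rules in $\mathcal{R}$ is a regular language. Then the monoid presented by $\langle A \mid \mathcal{R}\rangle$ is Markov, and the language of normal forms of $(A,\mathcal{R})$ is a Markov language for it. Furthermore, if $(A,\mathcal{R})$ is non-length-increasing, then the language of normal forms is a robust Markov language for this monoid.
   Context: A rewriting system $(A,\mathcal{R})$ consists of a finite alphabet $A$ and a (possibly infinite) set $\mathcal{R} \subseteq A^* \times A^*$ of rules $(\ell,r)$. Write $u \Rightarrow v$ if $u = x\ell y$ and $v = xry$ for some $(\ell,r) \in \mathcal{R}$, $x,y \in A^*$, and let $\Rightarrow^*$ be the reflexive transitive closure. The system is noetherian if there is no infinite sequence $u_1 \Rightarrow u_2 \Rightarrow \cdots$; confluent if whenever $u \Rightarrow^* u'$ and $u \Rightarrow^* u''$ there is $v$ with $u' \Rightarrow^* v$ and $u'' \Rightarrow^* v$; non-length-increasing if $|\ell| \geq |r|$ for every $(\ell,r) \in \mathcal{R}$. The language of normal forms is the set of words in $A^*$ containing no left-hand side of a rule as a subword (factor). The monoid presented by $\langle A \mid \mathcal{R}\rangle$ is the quotient of $A^*$ by the congruence generated by $\mathcal{R}$. A finite alphabet $A$ represents a generating set for a monoid $M$ if there is a map $\phi : A \to M$ extending to a surjective homomorphism $A^* \to M$; $\overline{w} = w\phi$ is the element represented by $w$. A language $L \subseteq A^*$ is prefix-closed if for all $u \in A^*$, $v \in A^+$, $uv \in L$ implies $u \in L$. A Markov language for $M$ over $A$ is a regular prefix-closed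 language $L \subseteq A^*$ such that every element of $M$ is represented by exactly one word of $L$; it is robust if moreover every $w \in L$ has minimal length among all words in $A^*$ representing $\overline{w}$. $M$ is Markov if it admits a Markov language over some finite alphabet representing a generating set. *)

(* Defs.v *)
(* The congruence generated by an infinite set of rules need not be decidable,
   hence the use of classical logic to form the quotient. *)
From HB Require Import structures.
From Stdlib Require Import Relation_Operators.
From mathcomp Require Import all_boot.
From mathcomp Require Import boolp classical_sets.

Set Implicit Arguments.
Unset Strict Implicit.
Unset Printing Implicit Defensive.

Local Open Scope classical_set_scope.

Definition language (A : finType) := set (seq A).

Definition regular (A : finType) (L : language A) : Prop :=
  exists (Q : finType) (q0 : Q) (delta : Q -> A -> Q) (F : {set Q}),
    forall w : seq A, L w <-> foldl delta q0 w \in F.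

Definition prefix_closed (A : finType) (L : language A) : Prop :=
  forall u v : seq A, v <> [::] -> L (u ++ v) -> L u.

Section Rewriting.
Variables (A : finType) (R : set (seq A * seq A)).
Implicit Types u v w x y l r : seq A.

Definition rewrites u v : Prop :=
  exists x y l r, [/\ R (l, r), u = x ++ l ++ y & v = x ++ r ++ y].

Definition rewrites_star : seq A -> seq A -> Prop :=
  clos_refl_trans (seq A) rewrites.

Definition noetherian : Prop :=
  ~ exists u_ : nat -> seq A, forall n, rewrites (u_ n) (u_ n.+1).

Definition confluent : Prop :=
  forall u u' u'', rewrites_star u u' -> rewrites_star u u'' ->
    exists v, rewrites_star u' v /\ rewrites_star u'' v.

Definition non_length_increasing : Prop :=
  forall l r, R (l, r) -> size r <= size l.

Definition left_hand_sides : language A := [set l | exists r, R (l, r)].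

Definition normal_forms : language A :=
  [set w | forall l, left_hand_sides l -> ~~ infix l w].

Inductive generated_congruence : seq A -> seq A -> Prop :=
| gc_rule l r : R (l, r) -> generated_congruence l r
| gc_refl u : generated_congruence u u
| gc_sym u v : generated_congruence u v -> generated_congruence v u
| gc_trans u v w : generated_congruence u v -> generated_congruence v w ->
    generated_congruence u w
| gc_cat u v x y : generated_congruence u v -> generated_congruence x y ->
    generated_congruence (u ++ x) (v ++ y).

Definition congruenceb : rel (seq A) := fun u v => `[< generated_congruence u v >].

Lemma congruenceb_refl : reflexive congruenceb.
Proof. by move=> u; apply/asboolP/gc_refl. Qed.

Lemma congruenceb_sym : symmetric congruenceb.
Proof. by move=> u v; apply/asboolP/asboolP => /gc_sym. Qed.

Lemma congruenceb_trans : transitive congruenceb.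
Proof.
by move=> v u w /asboolP uv /asboolP vw; apply/asboolP/(gc_trans uv vw).
Qed.

Canonical congruenceb_equiv :=
  EquivRel congruenceb congruenceb_refl congruenceb_sym congruenceb_trans.

Definition presented_monoid : Type := {eq_quot congruenceb}%qT.

HB.instance Definition _ := Choice.on presented_monoid.

Definition word_class (w : seq A) : presented_monoid :=
  (\pi_({eq_quot congruenceb}) w)%qT.

Definition word_repr (m : presented_monoid) : seq A :=
  repr (m : {eq_quot congruenceb}%qT).

Lemma word_reprK : cancel word_repr word_class.
Proof. exact: reprK. Qed.

Lemma word_classP u v : word_class u = word_class v <-> generated_congruence u v.
Proof.
split=> [/eqmodP /asboolP //|uv]; by apply/eqmodP/asboolP.
Qed.

Definition presented_mul (m n : presented_monoid) : presented_monoid :=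
  word_class (word_repr m ++ word_repr n).

Definition presented_one : presented_monoid := word_class [::].

Lemma word_class_cat u v :
  word_class (u ++ v) = presented_mul (word_class u) (word_class v).
Proof.
by apply/word_classP/gc_cat; apply/word_classP; rewrite word_reprK.
Qed.

Lemma presented_mulA : associative presented_mul.
Proof.
move=> m n p; rewrite -(word_reprK m) -(word_reprK n) -(word_reprK p).
by rewrite -!word_class_cat catA.
Qed.

Lemma presented_mul1 : left_id presented_one presented_mul.
Proof. by move=> m; rewrite -(word_reprK m) -word_class_cat. Qed.

Lemma presented_mulr1 : right_id presented_one presented_mul.
Proof. by move=> m; rewrite -(word_reprK m) -word_class_cat cats0. Qed.

HB.instance Definition _ := isMonoid.Build presented_monoid
  presented_mulA presented_mul1 presented_mulr1.

Definition letter_class (a : A) : presented_monoid := word_class [:: a].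

End Rewriting.

Section Markov.
Variables (A : finType) (M : monoidType) (phi : A -> M).

(* The unique extension of phi to a monoid homomorphism A^* -> M. *)
Definition word_value (w : seq A) : M := (\prod_(a <- w) phi a)%g.

Definition represents_generating_set : Prop :=
  forall m : M, exists w : seq A, word_value w = m.

Definition markov_language (L : language A) : Prop :=
  [/\ represents_generating_set, regular L, prefix_closed L &
      forall m : M, exists! w : seq A, L w /\ word_value w = m].

Definition robust_markov_language (L : language A) : Prop :=
  markov_language L /\
  forall w : seq A, L w ->
    forall w' : seq A, word_value w' = word_value w -> size w <= size w'.

End Markov.

Definition markov (M : monoidType) : Prop :=
  exists (A : finType) (phi : A -> M) (L : language A), markov_language phi L.

Lemma word_value_letter_class (A : finType) (R : set (seq A * seq A)) (w : seq A) :
  word_value (@letter_class A R) w = word_class R w.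
Proof.
rewrite /word_value; elim: w => [|a w IHw]; first by rewrite big_nil.
by rewrite big_cons IHw -cat1s word_class_cat.
Qed.

(* Main.v *)
(* Termination and confluence make each congruence class contain exactly one
   irreducible word, and every word of the class rewrites to it; with rules that
   do not increase length this word is therefore shortest in its class.
   Irreducible words are closed under factors, and they are recognised by running
   an automaton for the left-hand sides from every position of the input at once
   while remembering whether some run has ever accepted. *)
Require Import Defs.
From Stdlib Require Import Relation_Operators.
From mathcomp Require Import all_boot.
From mathcomp Require Import boolp classical_sets.

Set Implicit Arguments.
Unset Strict Implicit.
Unset Printing Implicit Defensive.

Section FactorAvoidance.
Variables (A : finType) (Q : finType) (q0 : Q) (delta : Q -> A -> Q) (F : {set Q}).
Implicit Types (l w : seq A) (a : A) (S : {set Q}).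

Definition meets S : bool := [exists q, (q \in S) && (q \in F)].

(** The empty word is already a factor of every input, so the flag starts at [q0 \in F] rather than
    [false]; this covers an empty left-hand side. *)
Definition factor_start : {set Q} * bool := ([set q0]%SET, q0 \in F).

(** Re-inserting [q0] starts a fresh run at the current position; the disjunction keeps the flag
    raised once some run has accepted. *)
Definition factor_step (st : {set Q} * bool) a : {set Q} * bool :=
  let S := (q0 |: [set delta q a | q in st.1])%SET in (S, st.2 || meets S).

(** Induction on the last letter. A suffix of [rcons w a] is empty or extends a suffix of [w] by
    [a]; a factor of [rcons w a] is a factor of [w] or a suffix of [rcons w a], so the new set of
    states suffices to update the flag. *)
Lemma factor_runP w :
  (forall q, q \in (foldl factor_step factor_start w).1 <->
     exists2 s, suffix s w & q = foldl delta q0 s) /\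
  ((foldl factor_step factor_start w).2 <->
     exists2 l, infix l w & foldl delta q0 l \in F).
Proof.
elim/last_ind: w => [|w a [IH1 IH2]].
  split=> [q|].
    rewrite finset.in_set1; split=> [/eqP ->|[s]]; first by exists [::].
    by rewrite suffixs0 => /eqP -> ->.
  split=> [q0F|[l]]; first by exists [::].
  by rewrite infixs0 => /eqP ->.
rewrite foldl_rcons; set st := foldl _ _ w in IH1 IH2 *.
have stepP q : q \in (factor_step st a).1 <->
    exists2 s, suffix s (rcons w a) & q = foldl delta q0 s.
  rewrite /= finset.in_setU1; split=> [/predU1P[->|/imsetP[p /IH1[s sw ->] ->]]|].
  - by exists [::] => //; rewrite suffix0s.
  - by exists (rcons s a); rewrite ?suffix_rcons ?eqxx ?foldl_rcons.
  case; case/lastP => [_ ->|s b]; first by rewrite eqxx.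
  rewrite suffix_rcons => /andP[/eqP -> sw] ->; rewrite foldl_rcons.
  by apply/orP; right; apply: imset_f; apply/IH1; exists s.
split=> //; split=> [/orP[/IH2[l lw lF]|/existsP[q /andP[/stepP[s sw ->] sF]]]|].
- by exists l => //; rewrite infix_rconsl lw orbT.
- by exists s => //; rewrite infix_rconsl sw.
case=> l; rewrite infix_rconsl => /orP[sw|lw] lF; apply/orP; [right|left].
  by apply/existsP; exists (foldl delta q0 l); rewrite lF andbT; apply/stepP; exists l.
by apply/IH2; exists l.
Qed.

End FactorAvoidance.

Section NormalForms.
Variables (A : finType) (R : set (seq A * seq A)).
Implicit Types u v w x y : seq A.

Lemma rewrites_star_cat u v x y :
  rewrites_star R u v -> rewrites_star R x y -> rewrites_star R (u ++ x) (v ++ y).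
Proof.
move=> uv xy; apply: (@rt_trans _ _ _ (v ++ x)).
  elim: uv => [u1 v1 [p [q [l [r [Rlr -> ->]]]]]|u1|u1 v1 w1 _ IH1 _ IH2].
  - by apply: rt_step; exists p, (q ++ x), l, r; rewrite -!catA.
  - exact: rt_refl.
  - exact: rt_trans IH1 IH2.
elim: xy => [u1 v1 [p [q [l [r [Rlr -> ->]]]]]|u1|u1 v1 w1 _ IH1 _ IH2].
- by apply: rt_step; exists (v ++ p), q, l, r; rewrite -!catA.
- exact: rt_refl.
- exact: rt_trans IH1 IH2.
Qed.

Lemma rewrites_star_congruence u v : rewrites_star R u v -> generated_congruence R u v.
Proof.
elim=> [u1 v1 [p [q [l [r [Rlr -> ->]]]]]|u1|u1 v1 w1 _ IH1 _ IH2].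
- apply: gc_cat; first exact: gc_refl.
  by apply: gc_cat; [exact: gc_rule|exact: gc_refl].
- exact: gc_refl.
- exact: gc_trans IH1 IH2.
Qed.

(** Only transitivity calls on confluence, to join the two descendants [s] and [t] of the middle
    word; for products, common descendants are concatenated. *)
Lemma church_rosser u v : confluent R -> generated_congruence R u v ->
  exists w, rewrites_star R u w /\ rewrites_star R v w.
Proof.
move=> cR; elim=> [l r Rlr|{}u|{}u {}v _ [w [uw vw]]|{}u {}v w _ [s [us vs]] _ [t [vt wt]]|].
- exists r; split; last exact: rt_refl.
  by apply: rt_step; exists [::], [::], l, r; rewrite !cats0.
- by exists u; split; exact: rt_refl.
- by exists w.
- have [z [sz tz]] := cR _ _ _ vs vt.
  by exists z; split; [exact: rt_trans us sz|exact: rt_trans wt tz].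
move=> {}u {}v x y _ [s [us vs]] _ [t [xt yt]].
by exists (s ++ t); split; exact: rewrites_star_cat.
Qed.

Lemma normal_forms_irreducible u v : normal_forms R u -> ~ rewrites R u v.
Proof.
move=> nu [x [y [l [r [Rlr u_eq _]]]]].
have := nu l (ex_intro _ r Rlr).
by rewrite u_eq infix_infix.
Qed.

Lemma irreducible_normal_forms u : (forall v, ~ rewrites R u v) -> normal_forms R u.
Proof.
move=> nu l [r Rlr]; apply/negP => /infixP[x [y u_eq]].
by apply: (nu (x ++ r ++ y)); exists x, y, l, r.
Qed.

Lemma normal_forms_star u v : normal_forms R u -> rewrites_star R u v -> u = v.
Proof.
move=> + uv; elim: uv => [u1 v1 uv1 /normal_forms_irreducible/(_ uv1)//|//|].
by move=> u1 v1 w1 _ IH1 _ IH2 nu; have uv := IH1 nu; rewrite uv; apply: IH2; rewrite -uv.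
Qed.

(** A word that reaches no normal form is reducible, and each of its successors is again such a
    word; iterating a choice of successor gives an infinite rewriting sequence. *)
Lemma normal_form_exists u : noetherian R ->
  exists2 v, rewrites_star R u v & normal_forms R v.
Proof.
move=> nR; apply: contrapT => bad_u; apply: nR.
pose bad w := ~ exists2 v, rewrites_star R w v & normal_forms R v.
have step w : exists v, bad w -> rewrites R w v /\ bad v.
  (* For a word that is not bad the value is arbitrary; it only makes the successor function
     total. *)
  have [bw|gw] := pselect (bad w); last by exists w.
  have [[v wv]|irr] := pselect (exists v, rewrites R w v).
    exists v => _; split=> // -[z vz nz]; apply: bw; exists z => //.
    by apply: rt_trans vz; exact: rt_step.
  exfalso; apply: bw; exists w; first exact: rt_refl.
  by apply: irreducible_normal_forms => v wv; apply: irr; exists v.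
have [f fP] := choice step.
have bad_iter n : bad (iter n f u) by elim: n => //= n /fP[].
by exists (fun n => iter n f u) => n /=; apply: (fP _ (bad_iter n)).1.
Qed.

(** A common descendant of [u] and [v] must be [v] itself, since an irreducible word rewrites only
    to itself. *)
Lemma congruence_normal_form u v : confluent R -> normal_forms R v ->
  generated_congruence R u v -> rewrites_star R u v.
Proof.
by move=> cR nv /(church_rosser cR)[w [uw /(normal_forms_star nv) ->]].
Qed.

Lemma rewrites_star_size u v : non_length_increasing R ->
  rewrites_star R u v -> size v <= size u.
Proof.
move=> sR; elim=> [u1 v1 [x [y [l [r [Rlr -> ->]]]]]|//|u1 v1 w1 _ IH1 _ IH2].
  by rewrite !size_cat leq_add2l leq_add2r; apply: sR.
exact: leq_trans IH2 IH1.
Qed.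

Lemma regular_normal_forms : regular (left_hand_sides R) -> regular (normal_forms R).
Proof.
move=> [Q [q0 [delta [F FP]]]].
exists ({set Q} * bool)%type, (factor_start q0 F), (factor_step q0 delta F).
exists [set st | ~~ st.2]%SET => w; rewrite inE.
have [_ runP] := factor_runP q0 delta F w; split=> [nw|/negP nb l /FP lF].
  by apply/negP => /runP[l lw /FP /nw]; rewrite lw.
by apply/negP => lw; apply/nb/runP; exists l.
Qed.

Lemma prefix_closed_normal_forms : prefix_closed (normal_forms R).
Proof.
move=> u v _ nuv l /nuv; apply: contra => lu.
by apply: (infix_trans lu); rewrite prefixW ?prefix_prefix.
Qed.

Lemma normal_forms_markov_language :
  confluent R -> noetherian R -> regular (left_hand_sides R) ->
  markov_language (@letter_class A R) (normal_forms R).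
Proof.
move=> cR nR rR; split.
- by move=> m; exists (word_repr m); rewrite word_value_letter_class word_reprK.
- exact: regular_normal_forms.
- exact: prefix_closed_normal_forms.
move=> m; have [v mv nv] := normal_form_exists (word_repr m) nR.
have mv_eq : word_class R v = m.
  by rewrite -[RHS]word_reprK; apply/word_classP/gc_sym/rewrites_star_congruence.
exists v; split=> [|w [nw]]; first by rewrite word_value_letter_class.
rewrite word_value_letter_class -mv_eq => /word_classP wv.
(* Uniqueness: [w] rewrites to the normal form [v], but is itself irreducible. *)
by apply/esym/(normal_forms_star nw)/congruence_normal_form.
Qed.

End NormalForms.

Theorem proposition7p1 (A : finType) (R : set (seq A * seq A)) :
  confluent R -> noetherian R -> regular (left_hand_sides R) ->
  markov (presented_monoid R) /\
  markov_language (@letter_class A R) (normal_forms R) /\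
  (non_length_increasing R ->
     robust_markov_language (@letter_class A R) (normal_forms R)).
Proof.
move=> cR nR rR; have mR := normal_forms_markov_language cR nR rR.
split; first by exists A, (@letter_class A R), (normal_forms R).
split=> // sR; split=> // w nw w'.
rewrite !word_value_letter_class => /word_classP w'w.
(* Any [w'] with the same value rewrites to [w], and no rewriting step lengthens a word. *)
exact/(rewrites_star_size sR)/congruence_normal_form.
Qed.
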